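(* Let $p$ be a prime number and let $\rho$ be an irreducible representation of dimension $n$ of $A_1(\mathbb{Z}/p\mathbb{Z})$ (on $(\mathbb{Z}/p\mathbb{Z})^n$). Suppose that $\rho(a)$ and $\rho(b)$ are invertible and set $\phi:=\rho(b)^{-1}$ and $\psi:=\rho(a)$. Then $X=\mathrm{Aff}((\mathbb{Z}/p\mathbb{Z})^n,\phi,\psi,c)$ is a simple latin affine cycle set for every $c\in(\mathbb{Z}/p\mathbb{Z})^n$. Moreover, $\mathcal{G}(X)$ is a $p$-group if and only if $\psi$ has prime-power order. Conversely, every finite affine simple latin cycle set with more than one element can be constructed in this way (up to isomorphism).
   Context: For a field $K$, the first Weyl algebra is $A_1(K)=K[a,b]/\langle ab-ba-1\rangle$ (the quotient of the free associative unital $K$-algebra on $a,b$). A left quasigroup $(X,\cdot)$ is a non-empty set with a binary operation such that $\sigma_x:y\mapsto x\cdot y$ is bijective for every $x$; it is latin if moreover $y\mapsto y\cdot x$ is bijective for every $x$. A cycle set is a left quasigroup with $(x\cdot y)\cdot(x\cdot z)=(y\cdot x)\cdot(y\cdot z)$ for all $x,y,z$; all cycle sets are assumed non-degenerate, i.e. $x\mapsto x\cdot x$ is bijective. For an abelian group $(G,+)$, $\phi\in\mathrm{End}(G,+)$, $\psi\in\mathrm{Aut}(G,+)$, $c\in G$, $\mathrm{Aff}(G,\phi,\psi,c)$ denotes the left quasigroup on $G$ with $x\cdot y=\phi(x)+\psi(y)+c$; left quasigroups (isomorphic to ones) of this form are called affine. $\mathcal{G}(X)=\langle\sigma_x\mid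 x\in X\rangle\le \mathrm{Sym}(X)$; $X$ is indecomposable if $\mathcal{G}(X)$ is transitive on $X$. A congruence is an equivalence relation $\sim$ such that $x\sim x'$ and $y\sim y'$ imply $x\cdot y\sim x'\cdot y'$ and $\sigma_x^{-1}(y)\sim\sigma_{x'}^{-1}(y')$. $X$ is simple if it is indecomposable and its only congruences are the equality relation and the all relation. *)

(* Defs.v *)
From HB Require Import structures.
From mathcomp Require Import all_boot all_order all_algebra all_fingroup.
From mathcomp Require Import all_solvable.
From mathcomp Require Import generic_quotient ring_quotient boolp.
From mathcomp Require Import finmap monalg.

Set Implicit Arguments.
Unset Strict Implicit.
Unset Printing Implicit Defensive.

Import GRing.Theory.
Local Open Scope ring_scope.
Local Open Scope quotient_scope.

(* ring_quotient only makes a ring of the quotient of a commutative ring, so the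
   quotient of an algebra by the two-sided ideal generated by r is built here. *)
Section TwoSidedQuotient.
Variables (K : fieldType) (A : algType K) (r : A).

Definition ideal_gen : {pred A} := fun f =>
  `[< exists s : seq (A * A), f = \sum_(uv <- s) uv.1 * r * uv.2 >].

Lemma ideal_genP f :
  reflect (exists s : seq (A * A), f = \sum_(uv <- s) uv.1 * r * uv.2)
          (f \in ideal_gen).
Proof. exact: asboolP. Qed.

Lemma ideal_gen_zmod_closed : zmod_closed ideal_gen.
Proof.
split=> [|f g]; first by apply/ideal_genP; exists [::]; rewrite big_nil.
move=> /ideal_genP[s ->] /ideal_genP[t ->]; apply/ideal_genP.
exists (s ++ [seq (- uv.1, uv.2) | uv <- t]).
rewrite big_cat big_map /=; congr (_ + _).
by rewrite -sumrN; apply: eq_bigr => uv _; rewrite !mulNr.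
Qed.

HB.instance Definition _ :=
  GRing.isZmodClosed.Build A ideal_gen ideal_gen_zmod_closed.

Lemma ideal_genMl u f : f \in ideal_gen -> u * f \in ideal_gen.
Proof.
move=> /ideal_genP[s ->]; apply/ideal_genP.
exists [seq (u * uv.1, uv.2) | uv <- s]; rewrite big_map mulr_sumr.
by apply: eq_bigr => uv _; rewrite !mulrA.
Qed.

Lemma ideal_genMr u f : f \in ideal_gen -> f * u \in ideal_gen.
Proof.
move=> /ideal_genP[s ->]; apply/ideal_genP.
exists [seq (uv.1, uv.2 * u) | uv <- s]; rewrite big_map mulr_suml.
by apply: eq_bigr => uv _; rewrite !mulrA.
Qed.

Lemma ideal_genZ k f : f \in ideal_gen -> k *: f \in ideal_gen.
Proof. by move=> fI; rewrite -[f]mul1r scalerAl ideal_genMl. Qed.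

Lemma mem_ideal_gen : r \in ideal_gen.
Proof.
by apply/ideal_genP; exists [:: (1, 1)]; rewrite big_seq1 mul1r mulr1.
Qed.

Hypothesis proper : 1 \notin ideal_gen.

Definition quot_alg of 1 \notin ideal_gen := Quotient.quot ideal_gen.
Local Notation Q := (quot_alg proper).
HB.instance Definition _ := GRing.Zmodule.on Q.
HB.instance Definition _ : EqQuotient A (Quotient.equiv ideal_gen) Q :=
  EqQuotient.on Q.

Definition quot_pi (f : A) : Q := \pi_Q f.

(* Locked so that comparing two elements does not unfold the operations of A. *)
Definition quot_one : Q := locked (quot_pi 1).
Definition quot_mul : Q -> Q -> Q :=
  locked (fun x y => quot_pi (repr x * repr y)).
Definition quot_scale : K -> Q -> Q :=
  locked (fun k x => quot_pi (k *: repr x)).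

Lemma quot_pi_eq f g : (quot_pi f == quot_pi g) = (f - g \in ideal_gen).
Proof. by rewrite Quotient.idealrBE. Qed.

Lemma quot_piK x : quot_pi (repr x) = x.
Proof. exact: reprK. Qed.

Lemma quot_piD f g : quot_pi (f + g) = quot_pi f + quot_pi g.
Proof. exact: Quotient.pi_add. Qed.

Lemma quot_pi0 : quot_pi 0 = 0.
Proof. by rewrite -[LHS](addrK (quot_pi 0)) -quot_piD addr0 subrr. Qed.

Lemma quot_pi_repr f : repr (quot_pi f) - f \in ideal_gen.
Proof. by rewrite -quot_pi_eq quot_piK. Qed.

Lemma quot_mul_pi f g : quot_mul (quot_pi f) (quot_pi g) = quot_pi (f * g).
Proof.
apply/eqP; rewrite /quot_mul -lock quot_pi_eq.
rewrite -[_ - _](subrKA (f * repr (quot_pi g))) -mulrBl -mulrBr.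
by apply: rpredD; [apply: ideal_genMr|apply: ideal_genMl]; apply: quot_pi_repr.
Qed.

Lemma quot_scale_pi k f : quot_scale k (quot_pi f) = quot_pi (k *: f).
Proof.
by apply/eqP; rewrite /quot_scale -lock quot_pi_eq -scalerBr ideal_genZ ?quot_pi_repr.
Qed.

Fact quot_mulA : associative quot_mul.
Proof.
move=> x y z; rewrite -[x]quot_piK -[y]quot_piK -[z]quot_piK.
by rewrite !quot_mul_pi mulrA.
Qed.

Lemma quot_one_pi : quot_one = quot_pi 1.
Proof. by rewrite /quot_one -lock. Qed.

Fact quot_mul1 : left_id quot_one quot_mul.
Proof. by move=> x; rewrite -[x]quot_piK quot_one_pi quot_mul_pi mul1r. Qed.

Fact quot_mulr1 : right_id quot_one quot_mul.
Proof. by move=> x; rewrite -[x]quot_piK quot_one_pi quot_mul_pi mulr1. Qed.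

Fact quot_mulDl : left_distributive quot_mul +%R.
Proof.
move=> x y z; rewrite -[x]quot_piK -[y]quot_piK -[z]quot_piK.
by rewrite -quot_piD !quot_mul_pi -quot_piD mulrDl.
Qed.

Fact quot_mulDr : right_distributive quot_mul +%R.
Proof.
move=> x y z; rewrite -[x]quot_piK -[y]quot_piK -[z]quot_piK.
by rewrite -quot_piD !quot_mul_pi -quot_piD mulrDr.
Qed.

Fact quot_one_neq0 : quot_one != 0.
Proof. by rewrite quot_one_pi -quot_pi0 quot_pi_eq subr0. Qed.

HB.instance Definition _ := GRing.Zmodule_isNzRing.Build Q
  quot_mulA quot_mul1 quot_mulr1 quot_mulDl quot_mulDr quot_one_neq0.

Fact quot_scaleA k l x : quot_scale k (quot_scale l x) = quot_scale (k * l) x.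
Proof. by rewrite -[x]quot_piK !quot_scale_pi scalerA. Qed.

Fact quot_scale1 : left_id 1 quot_scale.
Proof. by move=> x; rewrite -[x]quot_piK quot_scale_pi scale1r. Qed.

Fact quot_scaleDr : right_distributive quot_scale +%R.
Proof.
move=> k x y; rewrite -[x]quot_piK -[y]quot_piK.
by rewrite -quot_piD !quot_scale_pi -quot_piD scalerDr.
Qed.

Fact quot_scaleDl x : {morph quot_scale^~ x : k l / k + l}.
Proof.
by move=> k l; rewrite -[x]quot_piK !quot_scale_pi -quot_piD scalerDl.
Qed.

HB.instance Definition _ := GRing.Zmodule_isLmodule.Build K Q
  quot_scaleA quot_scale1 quot_scaleDr quot_scaleDl.

Lemma quot_piM f g : quot_pi (f * g) = quot_pi f * quot_pi g.
Proof. by rewrite -quot_mul_pi. Qed.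

Lemma quot_pi1 : quot_pi 1 = 1.
Proof. by rewrite -quot_one_pi. Qed.

Lemma quot_piZ k f : quot_pi (k *: f) = k *: quot_pi f.
Proof. by rewrite -quot_scale_pi. Qed.

Fact quot_scaleAl k (x y : Q) : k *: (x * y) = k *: x * y.
Proof.
by rewrite -[x]quot_piK -[y]quot_piK -!(quot_piM, quot_piZ) scalerAl.
Qed.

HB.instance Definition _ := GRing.Lmodule_isLalgebra.Build K Q quot_scaleAl.

Fact quot_scaleAr k (x y : Q) : k *: (x * y) = x * (k *: y).
Proof.
by rewrite -[x]quot_piK -[y]quot_piK -!(quot_piM, quot_piZ) scalerAr.
Qed.

HB.instance Definition _ := GRing.Lalgebra_isAlgebra.Build K Q quot_scaleAr.

End TwoSidedQuotient.

Fact malg_scalerAr (K : fieldType) (M : monomType) k (x y : {malg K[M]}) :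
  k *: (x * y) = x * (k *: y).
Proof.
have comm (c : K) (g : {malg K[M]}) : malgC c * g = g * malgC c.
  apply/malgP => m; rewrite mcoeffMl [RHS]mcoeffMr.
  apply: eq_bigr => m1 _; apply: eq_bigr => m2 _.
  rewrite mulrC mcoeffC; case: eqP => [->|_].
    by rewrite mulm1 mul1m.
  by rewrite mulr0n mulr0 !mul0rn.
by rewrite -!mul_malgC !mulrA comm.
Qed.

Section Weyl.
Variable K : fieldType.

(* The monoid algebra over K of the free monoid on the two letters false, true,
   that is, the free associative unital algebra on a := false and b := true. *)
Definition free2 := {malg K[{fmonom bool}]}.
HB.instance Definition _ := GRing.Lalgebra.on free2.

HB.instance Definition _ :=
  GRing.Lalgebra_isAlgebra.Build K free2 (@malg_scalerAr K {fmonom bool}).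

Definition gen (i : bool) : free2 := mkmalgU (fmu i) 1.
Definition weyl_rel : free2 :=
  gen false * gen true - gen true * gen false - 1.

(* The ideal is proper: a acts on {poly K} as the derivation and b as the
   multiplication by 'X, so that the relation acts as 0 and 1 as the identity. *)
Definition gen_act (i : bool) (f : {poly K}) := if i then 'X * f else f^`().
Definition act (g : free2) (f : {poly K}) : {poly K} :=
  \sum_(m <- msupp g) g@_m *: foldr gen_act f (m : seq bool).

Fact gen_act_is_linear i : linear (gen_act i).
Proof.
case: i => k f g /=; first by rewrite mulrDr scalerAr.
by rewrite derivD derivZ.
Qed.

Fact word_act_is_linear (m : seq bool) :
  linear (fun f => foldr gen_act f m).
Proof.
elim: m => //= i m IHm k f g.
by rewrite IHm gen_act_is_linear.
Qed.

Lemma actEw (d : {fset {fmonom bool}}) g f : (msupp g `<=` d)%fset ->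
  act g f = \sum_(m <- d) g@_m *: foldr gen_act f (m : seq bool).
Proof.
move=> le; rewrite [LHS](big_fset_incl _ le) => //= m _ /mcoeff_outdom ->.
by rewrite scale0r.
Qed.

Lemma actU c m f : act (mkmalgU m c) f = c *: foldr gen_act f (m : seq bool).
Proof. by rewrite (actEw _ msuppU_le) big_seq_fset1 mcoeffUU. Qed.

Lemma actB g h f : act (g - h) f = act g f - act h f.
Proof.
pose E := (msupp g `|` msupp h `|` msupp (g - h))%fset.
rewrite !(@actEw E) ?fsubsetUr //.
- by rewrite -sumrB; apply: eq_bigr => m _; rewrite mcoeffB scalerBl.
- by apply: fsubsetU; rewrite fsubsetUr.
- by apply: fsubsetU; rewrite fsubsetUl.
Qed.

Lemma act0 f : act 0 f = 0.
Proof. by rewrite -(subrr (0 : free2)) actB subrr. Qed.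

Lemma actD g h f : act (g + h) f = act g f + act h f.
Proof. by rewrite -[in LHS](opprK h) actB -(sub0r h) actB act0 sub0r opprK. Qed.

Lemma act_sum (T : Type) (s : seq T) (F : T -> free2) f :
  act (\sum_(i <- s) F i) f = \sum_(i <- s) act (F i) f.
Proof.
by elim: s => [|i s IHs]; rewrite ?big_nil ?act0 // !big_cons actD IHs.
Qed.

Lemma act1 f : act 1 f = f.
Proof. by rewrite -[1]/(mkmalgU _ 1) actU scale1r fm1. Qed.

Lemma actr0 g : act g 0 = 0.
Proof.
rewrite /act big1 // => m _.
have -> : foldr gen_act 0 (m : seq bool) = 0; last by rewrite scaler0.
by elim: (m : seq bool) => //= i w ->; case: i => /=; rewrite ?mulr0 ?deriv0.
Qed.

Lemma actM g h f : act (g * h) f = act g (act h f).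
Proof.
rewrite malgME act_sum [RHS]/act; apply: eq_bigr => m1 _.
rewrite act_sum /act.
have sumE (s : seq {fmonom bool}) (F : {fmonom bool} -> {poly K}) :
    foldr gen_act (\sum_(i <- s) F i) (m1 : seq bool)
    = \sum_(i <- s) foldr gen_act (F i) (m1 : seq bool).
  elim: s => [|i s IHs].
    rewrite !big_nil; elim: (m1 : seq bool) => //= j w ->.
    by case: j => /=; rewrite ?mulr0 ?deriv0.
  rewrite !big_cons -IHs -[F i]scale1r.
  by rewrite (word_act_is_linear m1 1) !scale1r.
rewrite sumE scaler_sumr; apply: eq_bigr => m2 _.
rewrite -/(act _ _) actU fmM foldr_cat -scalerA; congr (_ *: _).
rewrite -[in RHS](addr0 (_ *: _)) word_act_is_linear.
rewrite [X in _ + X](_ : _ = 0) ?addr0 //.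
by elim: (m1 : seq bool) => //= i w ->; case: i => /=; rewrite ?mulr0 ?deriv0.
Qed.

Lemma act_gen i f : act (gen i) f = gen_act i f.
Proof. by rewrite /gen actU scale1r fmU. Qed.

Lemma act_weyl_rel f : act weyl_rel f = 0.
Proof.
have commE (R : nzRingType) (ac : R -> {poly K} -> {poly K}) x y :
    (forall g h f, ac (g - h) f = ac g f - ac h f) ->
    (forall g h f, ac (g * h) f = ac g (ac h f)) ->
    (forall f, ac 1 f = f) ->
    ac (x * y - y * x - 1) f = ac x (ac y f) - ac y (ac x f) - f.
  by move=> acB acM ac1; rewrite !acB ac1 !acM.
rewrite [LHS](commE _ _ _ _ actB actM act1) 4!act_gen /=.
by rewrite derivM derivX mul1r addrK subrr.
Qed.

Lemma weyl_ideal_proper : 1 \notin ideal_gen weyl_rel.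
Proof.
apply/negP => /ideal_genP[s /(congr1 (act^~ 1))]; rewrite act1 act_sum big1.
  by move/eqP; rewrite oner_eq0.
by move=> uv _; rewrite !actM act_weyl_rel actr0.
Qed.

Definition weyl := quot_alg weyl_ideal_proper.
HB.instance Definition _ := GRing.Algebra.on weyl.

Definition weyl_a : weyl := quot_pi weyl_ideal_proper (gen false).
Definition weyl_b : weyl := quot_pi weyl_ideal_proper (gen true).

Lemma weyl_abE : weyl_a * weyl_b - weyl_b * weyl_a = 1.
Proof.
apply/eqP; rewrite subr_eq -!quot_piM -quot_pi1 -quot_piD quot_pi_eq.
by rewrite opprD addrA (addrAC _ (- 1)) mem_ideal_gen.
Qed.

(* Matrices act on column vectors from the left, so that a representation is a
   morphism for the usual product of matrices. *)
Definition irreducible_rep n (rho : {lrmorphism weyl -> 'M[K]_n}) : Prop :=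
  (0 < n)%N /\
  forall U : {vspace 'cV[K]_n},
    (forall x v, v \in U -> rho x *m v \in U) -> U = 0%VS \/ U = fullv.

End Weyl.

Arguments weyl_a {K}.
Arguments weyl_b {K}.

(* Finite left quasigroups, so that permutation groups are {group {perm X}}. *)
Record lquasigroup := LQuasigroup {
  lq_sort :> finType;
  lq_op : lq_sort -> lq_sort -> lq_sort;
  lq_neq0 : (0 < #|lq_sort|)%N;
  lq_bij : forall x, bijective (lq_op x)
}.

Declare Scope quasigroup_scope.
Delimit Scope quasigroup_scope with LQ.
Notation "x · y" := (lq_op x y) (at level 40, left associativity)
  : quasigroup_scope.
Local Open Scope quasigroup_scope.

Section LeftQuasigroups.
Variable X : lquasigroup.

Definition sigma (x : X) : {perm X} := perm (bij_inj (lq_bij x)).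

Definition mulgroup : {group {perm X}} := <<[set sigma x | x : X]>>%G.

Definition latin : Prop := forall x : X, bijective (fun y : X => y · x).

Definition cycle_set : Prop :=
  (forall x y z : X, (x · y) · (x · z) = (y · x) · (y · z))
  /\ bijective (fun x : X => x · x).

Definition indecomposable : bool :=
  [transitive mulgroup, on [set: X] | 'P].

Definition congruence (R : rel X) : Prop :=
  [/\ equivalence_rel R,
      forall x x' y y', R x x' -> R y y' -> R (x · y) (x' · y')
    & forall x x' y y', R x x' -> R y y' ->
        R ((sigma x)^-1%g y) ((sigma x')^-1%g y')].

Definition simple_lq : Prop :=
  indecomposable /\
  forall R : rel X, congruence R ->
    (forall x y, R x y = (x == y)) \/ (forall x y, R x y).

End LeftQuasigroups.

Definition lq_iso (X Y : lquasigroup) : Prop :=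
  exists2 f : X -> Y, bijective f & {morph f : x y / x · y}.

Section Affine.
Variables (G : finZmodType) (phi psi : {additive G -> G}).
Hypothesis psi_bij : bijective psi.
Variable c : G.

Definition aff_op (x y : G) : G := phi x + psi y + c.

Lemma aff_op_bij x : bijective (aff_op x).
Proof.
have [psi' psiK psi'K] := psi_bij.
exists (fun z => psi' (z - c - phi x)) => y; rewrite /aff_op.
  by rewrite addrK [phi x + _]addrC addrK psiK.
by rewrite psi'K [phi x + _]addrC !subrK.
Qed.

Lemma aff_neq0 : (0 < #|G|)%N.
Proof. by apply/card_gt0P; exists 0. Qed.

Definition Aff : lquasigroup := LQuasigroup aff_neq0 aff_op_bij.

End Affine.

Definition affine_lq (X : lquasigroup) : Prop :=
  exists (G : finZmodType) (phi psi : {additive G -> G})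
         (psi_bij : bijective psi) (c : G), lq_iso X (Aff phi psi_bij c).

Lemma mulmx_bij (K : fieldType) n (A : 'M[K]_n) :
  A \in unitmx -> bijective (mulmx A : 'cV[K]_n -> 'cV[K]_n).
Proof. by move=> uA; exists (mulmx (invmx A)); [exact: mulKmx|exact: mulKVmx]. Qed.

(* The order of psi in Aut(G,+) is its order in the symmetric group on G. *)
Definition prime_power_order (T : finType) (f : T -> T) (f_bij : bijective f) :
  Prop := exists q k, [/\ prime q, (0 < k)%N & #[perm (bij_inj f_bij)]%g = (q ^ k)%N].

(* Main.v *)
(* In X = Aff(G, phi, psi, c) with phi bijective, the cycle set identity reads
   phi psi - psi phi = phi^2, that is [psi, phi^-1] = 1, so that psi and phi^-1
   are the images of a and b under a representation of the Weyl algebra.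
   Congruences of X correspond to the subgroups of G stable under phi and psi,
   so X is simple iff G has no proper nontrivial stable subgroup. When X is
   simple the stable subgroup pG vanishes for any prime p dividing |G|, which
   makes G a vector space over F_p whose stable subgroups are the invariant
   subspaces. The permutations in G(X) are the maps psi^k followed by a
   translation, hence G(X) is a p-group iff psi has p-power order; and
   a^m b - b a^m = m a^(m-1) shows that p divides the order of psi, so p is the
   only prime of which that order can be a power. *)

Require Import Defs.
From HB Require Import structures.
From mathcomp Require Import all_boot all_order all_algebra all_fingroup.
From mathcomp Require Import all_solvable mxabelem.
From mathcomp Require Import generic_quotient finmap monalg.

Set Implicit Arguments.
Unset Strict Implicit.
Unset Printing Implicit Defensive.

Import GRing.Theory.
Local Open Scope ring_scope.

(** * Induction on, and the universal property of, the Weyl algebra *)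

(** The classes of words span the algebra, and a word grows by prepending one letter. This principle
    extends stability of a subspace under the two generators to every [rho x]. *)
Lemma weyl_ind (K : fieldType) (P : weyl K -> Prop) :
    P 1 -> (forall x y, P x -> P y -> P (x + y)) ->
    (forall k x, P x -> P (k *: x)) ->
    (forall x, P x -> P (weyl_a * x)) -> (forall x, P x -> P (weyl_b * x)) ->
  forall x, P x.
Proof.
move=> P1 PD PZ Pa Pb x.
rewrite -[x]quot_piK; move: (repr x) => g {x}.
pose pi := quot_pi (weyl_ideal_proper K).
have Pw (w : seq bool) : P (pi (mkmalgU (FMonom w) 1)).
  elim: w => [|i w IHw].
    by rewrite -fmoneE -/(1 : free2 K) /pi quot_pi1.
  have -> : FMonom (i :: w) = fmmul (fmu i) (FMonom w).
    by rewrite fmmulE fmuE.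
  have -> : mkmalgU (fmmul (fmu i) (FMonom w)) 1
      = gen K i * mkmalgU (FMonom w) 1 :> free2 K.
    by rewrite /gen malgM_def fgmulUU mulr1.
  by rewrite /pi quot_piM; case: i; [apply: Pb | apply: Pa].
have P0 : P 0 by rewrite -(scale0r 1); apply: PZ.
rewrite [g]monalgE.
elim: (msupp g : seq _) => [|m s IHs]; first by rewrite big_nil quot_pi0.
rewrite big_cons quot_piD; apply: PD => //.
have -> : mkmalgU m g@_m = g@_m *: (mkmalgU m 1 : free2 K) :> free2 K.
  by apply/malgP => m0; rewrite [RHS]mcoeffZ 2!mcoeffU mulr_natr.
by rewrite quot_piZ; apply: PZ; rewrite -(fmK m).
Qed.

Section WeylEval.
Variables (K : fieldType) (S : algType K) (A B : S).

Definition word_eval (w : {fmonom bool}) : S :=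
  \prod_(i <- (w : seq bool)) if i then B else A.

Fact word_eval_mmorphism : mmorphism word_eval.
Proof.
split=> [v w|]; last by rewrite /word_eval fm1 big_nil.
by rewrite /word_eval fmM big_cat.
Qed.

HB.instance Definition _ :=
  isMultiplicative.Build {fmonom bool} S word_eval word_eval_mmorphism.

Definition free_eval (g : free2 K) : S := mmap (in_alg S) word_eval g.

Lemma free_evalB : {morph free_eval : g h / g - h}.
Proof. exact: mmapB. Qed.

Lemma free_evalD : {morph free_eval : g h / g + h}.
Proof. exact: mmapD. Qed.

Lemma free_eval1 : free_eval 1 = 1.
Proof. exact: mmap1. Qed.

Lemma free_evalM : {morph free_eval : g h / g * h}.
Proof.
move=> g h; apply: (fst (@commr_mmap_is_multiplicative _ _ _ _ _ _)).
(* The images of the coefficients are scalars of [S], so they commute with the values of words. *)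
by move=> g' m m'; rewrite /GRing.comm /= mulr_algl mulr_algr.
Qed.

Lemma free_evalZ k g : free_eval (k *: g) = k *: free_eval g.
Proof. by rewrite /free_eval mmapZ /= mulr_algl. Qed.

Lemma free_eval_gen i : free_eval (gen K i) = if i then B else A.
Proof. by rewrite /free_eval mmapU /= scale1r mul1r /word_eval fmuE big_seq1. Qed.

Hypothesis AB : A * B - B * A = 1.

(** By [AB] the evaluation kills the relation, hence each of its two-sided multiples; it therefore
    descends to the quotient. *)
Lemma free_eval_ideal g : g \in ideal_gen (weyl_rel K) -> free_eval g = 0.
Proof.
have free_eval_rel : free_eval (weyl_rel K) = 0.
  have comm_eval x y : free_eval (x * y - y * x - 1)
      = free_eval x * free_eval y - free_eval y * free_eval x - 1.
    by rewrite 2!free_evalB 2!free_evalM free_eval1.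
  by rewrite [LHS]comm_eval 2!free_eval_gen AB subrr.
case/ideal_genP=> s ->.
elim: s => [|uv s IHs]; first by rewrite big_nil; apply: mmap0.
by rewrite big_cons free_evalD IHs !free_evalM free_eval_rel mulr0 mul0r addr0.
Qed.

Definition weyl_eval (x : weyl K) : S := free_eval (repr x).

Lemma weyl_eval_pi g :
  weyl_eval (quot_pi (weyl_ideal_proper K) g) = free_eval g.
Proof.
apply/eqP; rewrite -subr_eq0 -free_evalB free_eval_ideal //.
exact: quot_pi_repr.
Qed.

Fact weyl_eval_additive : zmod_morphism weyl_eval.
Proof.
move=> x y; rewrite -[x]quot_piK -[y]quot_piK.
rewrite -[- _]scaleN1r -quot_piZ -quot_piD !weyl_eval_pi scaleN1r.
exact: free_evalB.
Qed.

Fact weyl_eval_multiplicative : monoid_morphism weyl_eval.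
Proof.
split=> [|x y]; first by rewrite -quot_pi1 weyl_eval_pi free_eval1.
rewrite -[x]quot_piK -[y]quot_piK -quot_piM !weyl_eval_pi.
exact: free_evalM.
Qed.

Fact weyl_eval_scalable : scalable weyl_eval.
Proof.
move=> k x; rewrite -[x]quot_piK -quot_piZ !weyl_eval_pi.
exact: free_evalZ.
Qed.

Lemma weyl_universal :
  exists rho : {lrmorphism weyl K -> S}, rho weyl_a = A /\ rho weyl_b = B.
Proof.
pose mA := GRing.isZmodMorphism.Build _ _ _ weyl_eval_additive.
pose mM := GRing.isMonoidMorphism.Build _ _ _ weyl_eval_multiplicative.
pose mZ := GRing.isScalable.Build _ _ _ _ _ weyl_eval_scalable.
pose rho : {lrmorphism weyl K -> S} :=
  HB.pack weyl_eval mA mM mZ.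
by exists rho; rewrite /= !weyl_eval_pi !free_eval_gen.
Qed.

End WeylEval.

Local Open Scope quasigroup_scope.

(** * Affine left quasigroups in terms of [phi] and [psi] *)

(** An injection of the finite set [U] into itself is onto [U], so no point outside [U] can enter
    it. This gives stability under inverses for free. *)
Lemma mem_inj_stable (T : finType) (U : {pred T}) (f : T -> T) :
    injective f -> (forall x, x \in U -> f x \in U) ->
  forall x, (f x \in U) = (x \in U).
Proof.
move=> f_inj fU x; pose V := [set y in U].
have fVV : f @: V = V.
  apply/eqP; rewrite eqEcard card_imset // leqnn andbT.
  by apply/subsetP=> _ /imsetP[y + ->]; rewrite !inE; apply: fU.
by have := mem_imset V x f_inj; rewrite fVV !inE.
Qed.

Lemma sigma_mulgroup (X : lquasigroup) (x : X) : sigma x \in mulgroup X.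
Proof. by apply: mem_gen; apply: imset_f. Qed.

Section AffineTheory.
Variables (G : finZmodType) (phi psi : {additive G -> G}).
Hypothesis psi_bij : bijective psi.
Variable c : G.
Local Notation X := (Aff phi psi_bij c).

(** In other words, [G] is zero or a simple module over the ring generated by [phi] and [psi]. *)
Definition irreducible_pair : Prop := forall U : {pred G}, zmod_closed U ->
    (forall x, x \in U -> phi x \in U) -> (forall x, x \in U -> psi x \in U) ->
  (forall x, (x \in U) = (x == 0)) \/ (forall x, x \in U).

Lemma sigma_affE x y : sigma (x : X) y = phi x + psi y + c.
Proof. by rewrite permE. Qed.

Lemma latin_aff : latin X <-> injective phi.
Proof.
split=> [lat x y eq_phi | phi_inj x].
  by apply: (bij_inj (lat 0)); rewrite /= /aff_op eq_phi.
by apply: injF_bij => y z /addIr/addIr/phi_inj.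
Qed.

(** After expansion the terms in [z] and [c] agree on both sides. What remains says that a sum of an
    additive function of [x] and one of [y] is symmetric, and [y = 0] shows that the two functions
    coincide. *)
Lemma cycle_identity_aff :
  (forall x y z : X, (x · y) · (x · z) = (y · x) · (y · z)) <->
  (forall x, phi (phi x) + psi (phi x) = phi (psi x)).
Proof.
have expand x y z : aff_op phi psi c (aff_op phi psi c x y) (aff_op phi psi c x z)
    = phi (phi x) + psi (phi x) + phi (psi y)
      + (phi c + psi (psi z) + psi c + c).
  by rewrite /aff_op !raddfD /= [LHS](AC (3*3*1) (1*4*2*(3*5*6*7))).
split=> [cyc x | rel x y z].
  have := cyc x 0 0; rewrite /= !expand => /addIr.
  by rewrite !raddf0 addr0 !add0r.
rewrite /= !expand; congr (_ + _).
by rewrite !rel addrC.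
Qed.

(** Up to translation by [c] the squaring map is [phi + psi], which the relation turns into the
    conjugate of [psi] by [phi]. *)
Lemma diag_aff_bij : injective phi ->
  (forall x, phi (phi x) + psi (phi x) = phi (psi x)) ->
  bijective (fun x : X => x · x).
Proof.
move=> phi_inj rel; apply: injF_bij => x y /addIr.
have [phi' phiK phi'K] := injF_bij phi_inj.
have phipsiE z : phi z + psi z = phi (psi (phi' z)).
  by rewrite -rel phi'K.
by rewrite !phipsiE => /phi_inj/(bij_inj psi_bij)/(can_inj phi'K).
Qed.

(** Congruence modulo a stable subgroup [U] is a congruence of [X], and [U] is its class of 0. *)
Lemma aff_simple_irreducible :
    (forall R : rel X, congruence R ->
       (forall x y, R x y = (x == y)) \/ (forall x y, R x y)) ->
  irreducible_pair.
Proof.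
move=> simpleX U Uzmod Uphi Upsi; have psi_inj := bij_inj psi_bij.
have [U0 UB] := Uzmod.
have UN x : x \in U -> - x \in U by move=> Ux; rewrite -sub0r UB.
have UD x y : x \in U -> y \in U -> x + y \in U.
  by move=> Ux Uy; rewrite -[y]opprK UB ?UN.
pose R : rel X := fun x y : G => (x - y) \in U.
have congR : congruence R.
  split=> [x y z | x x' y y' Rx Ry | x x' y y' Rx Ry].
  - split=> [|Rxy]; rewrite /R ?subrr //.
    apply/idP/idP => H; first by rewrite -(subrKA x) UD // -opprB UN.
    by rewrite -(subrKA y) UD.
  - have -> : R (x · y) (x' · y') = (phi (x - x') + psi (y - y') \in U).
      by rewrite /R /= /aff_op opprD addrACA subrr addr0 opprD addrACA -!raddfB.
    by rewrite UD ?Uphi ?Upsi.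
  - set u : G := (sigma x)^-1%g y; set u' : G := (sigma x')^-1%g y'.
    have yE : y = phi x + psi u + c by rewrite -sigma_affE permKV.
    have y'E : y' = phi x' + psi u' + c by rewrite -sigma_affE permKV.
    (* Since [psi] permutes the finite set [U], the difference may be tested after applying [psi],
       where the inverses of the [sigma] disappear. *)
    rewrite /R -(mem_inj_stable psi_inj) //.
    have -> : psi (u - u') = (y - y') - phi (x - x').
      rewrite yE y'E opprD addrACA subrr addr0 opprD addrACA -!raddfB.
      by rewrite addrAC subrr add0r.
    by rewrite UB ?Uphi.
have [Req | Rall] := simpleX R congR; [left=> x | right=> x].
  by have := Req x 0; rewrite /R subr0.
by have := Rall x 0; rewrite /R subr0.
Qed.

(* Every translation of G is the inverse of sigma_0 followed by some sigma_x,
   so a congruence is translation invariant, hence given by its class of 0. *)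
Lemma aff_irreducible_simple : injective phi -> irreducible_pair -> simple_lq X.
Proof.
move=> phi_inj irr; have [phi' phiK phi'K] := injF_bij phi_inj.
split.
  apply/imsetP; exists 0 => //; apply/esym/setP=> z; rewrite inE.
  (* The index is chosen so that its [sigma] sends 0 to [z]; thus the orbit of 0 is everything. *)
  apply/orbitP; exists (sigma (phi' (z - c) : X)); first exact: sigma_mulgroup.
  by rewrite /= apermE sigma_affE raddf0 addr0 phi'K subrK.
move=> R [Requiv Rop Rdiv].
have [Rxx Rl] := (equivalence_relP R).1 Requiv.
have Rsym x y : R x y -> R y x by move=> /Rl <-.
have RD t x y : R x y -> R (x + t) (y + t).
  move=> Rxy.
  have divE z : (phi' t : X) · ((sigma (0 : X))^-1%g z) = z + t.
    rewrite /= /aff_op phi'K; have := permKV (sigma (0 : X)) z.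
    by rewrite sigma_affE raddf0 add0r => {2}<-; rewrite -addrA addrC.
  by rewrite -!divE; apply: (Rop _ _ _ _ (Rxx _)); apply: Rdiv.
have R0 x y : R x y = R (x - y) 0.
  apply/idP/idP => [/(RD (- y))|/(RD y)]; first by rewrite subrr.
  by rewrite subrK add0r.
have Rpsi x : R x 0 -> R (psi x) 0.
  move=> Rx; have := Rop _ _ _ _ (Rxx 0) Rx.
  by rewrite [X in is_true X -> _]R0 /= /aff_op !raddf0 addr0 !add0r addrK.
have Rphi x : R x 0 -> R (phi x) 0.
  move=> Rx; have := Rop _ _ _ _ Rx (Rxx 0).
  by rewrite [X in is_true X -> _]R0 /= /aff_op !raddf0 !addr0 !add0r addrK.
have UP x : (x \in [pred x | R x 0]) = R x 0 by [].
have Uzmod : zmod_closed [pred x | R x 0].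
  split=> [|x y]; rewrite !UP // => Rx Ry.
  by rewrite -R0 (Rl _ _ Rx); apply: Rsym.
case: (irr [pred x | R x 0]) => // [Req | Rall]; [left | right] => x y.
  by rewrite R0 -UP Req subr_eq0.
by rewrite R0 -UP Rall.
Qed.

Local Notation s := (perm (bij_inj psi_bij)).

Lemma perm_expD k : {morph (s ^+ k)%g : x y / x + y}.
Proof.
move=> x y; rewrite !permX.
by elim: k => //= k IHk; rewrite IHk !permE raddfD.
Qed.

Lemma perm_exp0 k : (s ^+ k)%g 0 = 0.
Proof. by apply: (addrI ((s ^+ k)%g 0)); rewrite -perm_expD !addr0. Qed.

(** Each generator is [psi] followed by a translation, and additivity of the powers of [psi] lets
    translations be moved past them. By finiteness, products of generators suffice. *)
Lemma mulgroup_affP (g : {perm X}) : g \in mulgroup X ->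
  exists k t, forall x, g x = (s ^+ k)%g x + t.
Proof.
case/gen_prodgP=> m [d dS ->]; elim/big_ind: _ => [|g1 g2 | i _].
- by exists 0%N, 0 => x; rewrite expg0 !perm1 addr0.
- move=> [k1 [t1 g1E]] [k2 [t2 g2E]].
  exists (k1 + k2)%N, ((s ^+ k2)%g t1 + t2) => x.
  by rewrite permM g1E g2E expgD permM perm_expD addrA.
- have /imsetP[x _ ->] := dS i; exists 1%N, (phi x + c) => y.
  by rewrite expg1 sigma_affE permE [phi x + _]addrC addrA.
Qed.

Lemma perm_aff_exp (g : {perm X}) k t :
    (forall x, g x = (s ^+ k)%g x + t) ->
  forall m, exists u, forall x, (g ^+ m)%g x = (s ^+ (k * m))%g x + u.
Proof.
move=> gE; elim=> [|m [u IHm]].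
  by exists 0 => x; rewrite muln0 !expg0 !perm1 addr0.
exists ((s ^+ k)%g u + t) => x.
by rewrite expgSr permM IHm gE mulnSr expgD permM perm_expD addrA.
Qed.

(** The order of [psi] divides that of [sigma 0]. Conversely, an element of prime order [q], raised
    to the order of [psi], becomes a translation, which [p] kills; so [q] divides [p] times the
    order of [psi]. *)
Lemma mulgroup_pgroup_aff p : prime p -> (forall x : G, x *+ p = 0) ->
  (p.-group (mulgroup X))%g <-> (p.-nat #[s])%g.
Proof.
move=> p_pr Gp; split=> [pX | ps].
  have := mem_p_elt pX (sigma_mulgroup (0 : X)); apply: pnat_dvd.
  have [] := @perm_aff_exp (sigma (0 : X)) 1 c _ #[sigma (0 : X)]%g.
    by move=> x; rewrite expg1 sigma_affE permE raddf0 add0r.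
  move=> u; rewrite expg_order mul1n => uE.
  (* Evaluation at 0, which powers of [psi] fix, isolates the translation part. *)
  have u0 : u = 0 by have := uE 0; rewrite perm1 perm_exp0 add0r.
  rewrite order_dvdn; apply/eqP/permP => x.
  by have := uE x; rewrite u0 addr0 !perm1.
apply/pgroupP => q q_pr /(Cauchy q_pr)[g gX gq].
have [k [t gE]] := mulgroup_affP gX.
have [u gmE] := perm_aff_exp gE #[s]%g.
have gtrans x : (g ^+ #[s])%g x = x + u.
  by rewrite gmE mulnC expgM expg_order expg1n perm1.
have gXE j x : ((g ^+ #[s]) ^+ j)%g x = x + u *+ j.
  elim: j x => [|j IHj] x; first by rewrite expg0 perm1 addr0.
  by rewrite expgSr permM IHj gtrans mulrSr addrA.
have : (#[g]%g %| #[s]%g * p)%N.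
  rewrite order_dvdn expgM; apply/eqP/permP => x.
  by rewrite gXE Gp addr0 perm1.
rewrite gq; apply: pnatP => //; last by rewrite pnatM ps pnat_id.
by rewrite muln_gt0 order_gt0 prime_gt0.
Qed.

End AffineTheory.

(** * Matrices over a prime field and representations of the Weyl algebra *)

(** The commutator with [b] is a derivation sending [a] to 1, so powers of [a] differentiate as
    usual; the induction step is the Leibniz rule. *)
Lemma expr_commutator (R : pzRingType) (a b : R) m :
  a * b - b * a = 1 -> a ^+ m.+1 * b - b * a ^+ m.+1 = a ^+ m *+ m.+1.
Proof.
move=> ab; elim: m => [|m IHm]; first by rewrite !expr1 expr0.
rewrite exprS -mulrA -(subrKA (a * (b * a ^+ m.+1))) -mulrBr IHm.
by rewrite !mulrA -mulrBl ab mul1r mulrnAr -exprS -mulrSr.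
Qed.

Lemma mulmx_id_eq1 (K : fieldType) n (A : 'M[K]_n) :
  (forall v : 'cV_n, A *m v = v) -> A = 1%:M.
Proof.
move=> Av; apply/trmx_inj/row_matrixP => j.
by rewrite -!tr_col !colE Av mul1mx.
Qed.

Lemma unitmx_inj (K : fieldType) n (A : 'M[K]_n) :
  injective (mulmx A : 'cV_n -> 'cV_n) -> A \in unitmx.
Proof.
move=> A_inj; rewrite -unitmx_tr -row_free_unit -kermx_eq0; apply/rowV0P => v.
move=> /sub_kermxP/(congr1 trmx); rewrite trmx_mul trmxK trmx0 => Av0.
by apply/trmx_inj/A_inj; rewrite Av0 trmx0 mulmx0.
Qed.

(** Multiplying the right-hand relation by [B] on both sides turns it into [1 + B A = A B]. *)
Lemma weyl_inv_relation (K : fieldType) n (A B : 'M[K]_n) : B \in unitmx ->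
  A *m B - B *m A = 1%:M <->
  (forall v : 'cV_n, invmx B *m (invmx B *m v) + A *m (invmx B *m v)
                     = invmx B *m (A *m v)).
Proof.
move=> uB; split=> [AB v | rel].
  have -> : invmx B *m (invmx B *m v)
      = invmx B *m ((A *m B - B *m A) *m (invmx B *m v)) by rewrite AB mul1mx.
  by rewrite mulmxBl mulmxBr -!mulmxA mulKmx // mulKVmx // subrK.
apply: mulmx_id_eq1 => v; have := rel (B *m v); rewrite mulKmx //.
move=> /(congr1 (mulmx B)); rewrite mulmxDr !mulKVmx // mulmxBl -!mulmxA => <-.
by rewrite addrK.
Qed.

Section PrimeField.
Variable p : nat.
Implicit Types n m : nat.

(** Scaling is repeated addition, which is why subgroups are subspaces and additive maps are linear
    in what follows. *)
Lemma Fp_scale_natmul (V : lmodType 'F_p) (k : 'F_p) (v : V) :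
  k *: v = v *+ (k : nat).
Proof. by rewrite -[in LHS](natr_Zp k) scaler_nat. Qed.

Lemma zmod_closed_vspace n (U : {pred 'cV['F_p]_n}) :
  zmod_closed U -> exists V : {vspace 'cV['F_p]_n}, V =i U.
Proof.
move=> [U0 UB].
have UD x y : x \in U -> y \in U -> x + y \in U.
  by move=> Ux Uy; rewrite -[y]opprK -[- y]sub0r !UB.
have UM x k : x \in U -> x *+ k \in U.
  by move=> Ux; elim: k => // k IHk; rewrite mulrS UD.
exists <<enum U>>%VS => v; apply/idP/idP => [| Uv]; last first.
  by rewrite memv_span ?mem_enum.
move=> /(coord_span (X := in_tuple (enum U))) ->.
elim/big_ind: _ => // i _; rewrite Fp_scale_natmul UM //.
by rewrite -[_ \in U]mem_enum mem_nth.
Qed.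

Lemma additive_Fp_mulmx n m (f : 'cV['F_p]_n -> 'cV['F_p]_m) :
  {morph f : x y / x + y} -> exists A : 'M_(m, n), forall v, f v = A *m v.
Proof.
move=> fD; have f0 : f 0 = 0 by apply: (addrI (f 0)); rewrite -fD !addr0.
have fM v k : f (v *+ k) = f v *+ k.
  by elim: k => // k IHk; rewrite !mulrS fD IHk.
exists (\matrix_(i, j) f (delta_mx j 0) i 0) => v.
rewrite {1}[v]matrix_sum_delta (big_morph f fD f0).
apply/colP => i; rewrite summxE mxE; apply: eq_bigr => j _.
by rewrite big_ord1 Fp_scale_natmul fM -Fp_scale_natmul !mxE mulrC.
Qed.

Lemma elementary_abelian_column (G : finZmodType) :
    prime p -> (1 < #|G|)%N -> (forall x : G, x *+ p = 0) ->
  exists n (h : G -> 'cV['F_p]_n.+1), bijective h /\ {morph h : x y / x + y}.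
Proof.
move=> p_pr G_gt1 Gp; pose E := [set: G]%G.
have abE : (p.-abelem E)%g.
  by rewrite abelemE // FinRing.Theory.zmod_abelian; apply/exponentP => x _; apply: Gp.
have ntE : E :!=: 1%g by rewrite -cardG_gt1 cardsT.
(* The coordinates of an elementary abelian group are row vectors, hence the transpose;
   nontriviality makes the dimension a successor. *)
exists (abelem_dim' E), (fun x => (abelem_rV abE ntE x)^T); split.
  exists (fun v => rVabelem abE ntE v^T) => [x | v].
    by rewrite trmxK abelem_rV_K ?inE.
  by rewrite rVabelemK trmxK.
by move=> x y; rewrite -FinRing.Theory.zmodMgE abelem_rV_M ?inE // raddfD.
Qed.

Section Representation.
Variables (n : nat) (rho : {lrmorphism weyl 'F_p -> 'M['F_p]_n}).
Hypotheses (ua : rho weyl_a \in unitmx) (ub : rho weyl_b \in unitmx).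

Lemma rho_weyl_rel : rho weyl_a *m rho weyl_b - rho weyl_b *m rho weyl_a = 1%:M.
Proof.
have := congr1 rho (weyl_abE 'F_p).
by rewrite rmorphB !rmorphM rmorph1.
Qed.

(** Stable subgroups and invariant subspaces are the same: subgroups are subspaces, finiteness
    exchanges [rho weyl_b] with its inverse, and [weyl_ind] passes from the generators to the whole
    algebra. *)
Lemma irreducible_rep_pair : irreducible_rep rho <->
  (0 < n)%N /\ irreducible_pair (mulmx (invmx (rho weyl_b)) : 'cV_n -> 'cV_n)
                                (mulmx (rho weyl_a)).
Proof.
have invb_inj := bij_inj (mulmx_bij (etrans (unitmx_inv _) ub)).
split=> [[n0 irr] | [n0 irr]]; split=> // U.
  move=> Uzmod Ub Ua.
  have [V VU] := zmod_closed_vspace Uzmod.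
  have Vstable x v : v \in V -> rho x *m v \in V.
    elim/weyl_ind: x v => [|x y IHx IHy|k x IHx|x IHx|x IHx] v Vv.
    - by rewrite rmorph1 mul1mx.
    - by rewrite raddfD mulmxDl rpredD ?IHx ?IHy.
    - by rewrite linearZ -scalemxAl rpredZ ?IHx.
    - by rewrite rmorphM -mulmxA VU Ua // -VU IHx.
    - rewrite rmorphM -mulmxA VU -(mem_inj_stable invb_inj Ub) mulKmx //.
      by rewrite -VU IHx.
  case: (irr V Vstable) => VE; [left | right] => v; rewrite -VU VE.
    by rewrite memv0.
  by rewrite memvf.
move=> Ustable.
have Ub v : v \in U -> invmx (rho weyl_b) *m v \in U.
  have b_inj := bij_inj (mulmx_bij ub).
  by rewrite -(mem_inj_stable b_inj (Ustable weyl_b) (_ *m v)) mulKVmx.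
case: (irr (mem U)) => [||v|UE|UE].
- by split=> [|u v]; [exact: mem0v | exact: rpredB].
- exact: Ub.
- exact: Ustable.
- by left; apply/vspaceP => v; rewrite memv0 -UE.
- by right; apply/vspaceP => v; rewrite memvf UE.
Qed.

Lemma prime_dvd_order_a : prime p -> (0 < n)%N ->
  (p %| #[perm (bij_inj (mulmx_bij ua : bijective (mulmx (rho weyl_a))))]%g)%N.
Proof.
set s := perm _ => p_pr n_gt0.
pose A : 'M_n := rho weyl_a.
have sE m v : (s ^+ m)%g v = (A ^+ m : 'M_n) *m v.
  rewrite permX; elim: m => [|m IHm]; first by rewrite expr0 mul1mx.
  by rewrite /= IHm permE exprS mulmxA.
have : A ^+ #[s]%g = 1.
  by apply: mulmx_id_eq1 => v; rewrite -sE expg_order perm1.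
have := order_gt0 s; case: #[s]%g => // m _ am1.
have := expr_commutator m (rho_weyl_rel : A * rho weyl_b - rho weyl_b * A = 1).
(* As [a ^+ m.+1] is 1, its commutator with [b] vanishes. Multiplying by [A] leaves [m.+1] times the
   identity equal to 0, and a diagonal entry, available since [n] is positive, gives divisibility by
   [p]. *)
rewrite am1 mul1r mulr1 subrr => /(congr1 ( *%R A)).
rewrite mulr0 mulrnAr -exprS am1 => /matrixP/(_ (Ordinal n_gt0) (Ordinal n_gt0)).
rewrite -scaler_nat !mxE eqxx mulr1 => /esym/eqP.
by rewrite -(dvdn_pcharf (pchar_Fp p_pr)).
Qed.

End Representation.
End PrimeField.

(** * Transport of properties along isomorphisms *)

Lemma lq_iso_refl (X : lquasigroup) : lq_iso X X.
Proof. by exists id => //; exists id. Qed.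

Section Transport.
Variables (X Y : lquasigroup) (f : X -> Y).
Hypotheses (f_bij : bijective f) (fM : {morph f : x y / x · y}).

Lemma lq_iso_sigmaV x y : f ((sigma x)^-1%g y) = (sigma (f x))^-1%g (f y).
Proof.
have yE : x · (sigma x)^-1%g y = y by rewrite -[RHS](permKV (sigma x)) [RHS]permE.
by apply: (@perm_inj _ (sigma (f x))); rewrite permKV [LHS]permE -fM yE.
Qed.

Lemma lq_iso_latin : latin X -> latin Y.
Proof.
move=> latX y; have [g fK gK] := f_bij.
apply: injF_bij => y1 y2; rewrite -(gK y1) -(gK y2) -(gK y) -!fM.
by move=> /(bij_inj f_bij)/(bij_inj (latX _)) ->.
Qed.

Lemma lq_iso_cycle_identity :
  (forall x y z : X, (x · y) · (x · z) = (y · x) · (y · z)) ->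
  forall x y z : Y, (x · y) · (x · z) = (y · x) · (y · z).
Proof.
have [g _ gK] := f_bij.
by move=> cyc x y z; rewrite -(gK x) -(gK y) -(gK z) -!fM cyc.
Qed.

Lemma lq_iso_congruences :
    (forall R : rel X, congruence R ->
       (forall x y, R x y = (x == y)) \/ (forall x y, R x y)) ->
  forall R : rel Y, congruence R ->
    (forall x y, R x y = (x == y)) \/ (forall x y, R x y).
Proof.
have [g fK gK] := f_bij; move=> simpleX R [Req Rop Rdiv].
(* The congruence on [Y] is pulled back to [X] along [f]. *)
case: (simpleX (fun x y => R (f x) (f y))) => [|Rid|Rall]; last 2 first.
- by left=> x y; rewrite -(gK x) -(gK y) Rid (inj_eq (bij_inj f_bij)).
- by right=> x y; rewrite -(gK x) -(gK y).
split=> [x y z | x x' y y' | x x' y y'].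
- exact: Req.
- by rewrite !fM; apply: Rop.
- by rewrite !lq_iso_sigmaV; apply: Rdiv.
Qed.

End Transport.

(** * The exponent of [G], and the two directions of the correspondence *)

Lemma irreducible_exponent (G : finZmodType) (phi psi : {additive G -> G}) :
    (1 < #|G|)%N -> irreducible_pair phi psi ->
  exists2 p, prime p & forall x : G, x *+ p = 0.
Proof.
move=> G_gt1 irr; pose p := pdiv #|G|.
have p_pr : prime p by apply: pdiv_prime.
exists p => // x; pose U := [set y *+ p | y : G].
have UP y : y *+ p \in U by apply: imset_f.
case: (irr (mem U)) => [|y|y|U0|Uall].
- split=> [|_ _ /imsetP[y _ ->] /imsetP[z _ ->]].
    by rewrite -(mul0rn _ p) UP.
  by rewrite -mulrnBl UP.
- by case/imsetP=> z _ ->; rewrite raddfMn UP.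
- by case/imsetP=> z _ ->; rewrite raddfMn UP.
- by apply/eqP; rewrite -U0 UP.
(* If [pG] were all of [G], multiplication by [p] would be injective by finiteness, against the
   element of order [p] given by Cauchy. *)
have mul_inj : injective (fun y : G => y *+ p).
  have /imset_injP inj : #|U| == #|G|.
    rewrite eqn_leq leq_imset_card /=.
    by apply: subset_leq_card; apply/subsetP=> y _; apply: Uall.
  by move=> y z; apply: inj.
have [|y _ oy] := @Cauchy _ p [set: G]%G p_pr; first by rewrite cardsT pdiv_dvd.
have /mul_inj y0 : y *+ p = 0 *+ p.
  by rewrite mul0rn -[_ *+ _]/(y ^+ p)%g -oy expg_order.
by move: p_pr; rewrite -oy y0 order1.
Qed.

Lemma latin_simple_cycle_affine (p n : nat)
    (rho : {lrmorphism weyl 'F_p -> 'M['F_p]_n})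
    (ua : rho weyl_a \in unitmx) (ub : rho weyl_b \in unitmx) (c : 'cV['F_p]_n) :
  irreducible_rep rho ->
  let X := Aff (mulmx (invmx (rho weyl_b)))
               (mulmx_bij ua : bijective (mulmx (rho weyl_a))) c in
  [/\ simple_lq X, latin X, affine_lq X & cycle_set X].
Proof.
move=> irr X; have [n_gt0 irr_pair] := (irreducible_rep_pair ub).1 irr.
have phi_inj : injective (mulmx (invmx (rho weyl_b)) : 'cV_n -> 'cV_n).
  by apply/bij_inj/mulmx_bij; rewrite unitmx_inv.
have rel := (weyl_inv_relation (rho weyl_a) ub).1 (rho_weyl_rel rho).
split.
- exact: aff_irreducible_simple.
- exact/latin_aff.
- exists 'cV_n, (mulmx (invmx (rho weyl_b))), (mulmx (rho weyl_a)).
  by exists (mulmx_bij ua), c; apply: lq_iso_refl.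
- by split; [exact/cycle_identity_aff | exact: diag_aff_bij].
Qed.

Lemma mulgroup_pgroup_prime_power (p n : nat)
    (rho : {lrmorphism weyl 'F_p -> 'M['F_p]_n})
    (ua : rho weyl_a \in unitmx) (c : 'cV['F_p]_n) :
  prime p -> irreducible_rep rho ->
  let X := Aff (mulmx (invmx (rho weyl_b)))
               (mulmx_bij ua : bijective (mulmx (rho weyl_a))) c in
  (p.-group (mulgroup X))%g <->
  prime_power_order (mulmx_bij ua : bijective (mulmx (rho weyl_a))).
Proof.
move=> p_pr [n_gt0 _] X.
have p_dvd := prime_dvd_order_a ua p_pr n_gt0.
have killed (v : 'cV['F_p]_n) : v *+ p = 0.
  by rewrite -scaler_nat pchar_Fp_0 // scale0r.
apply: (iff_trans (mulgroup_pgroup_aff _ _ _ p_pr killed)).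
split=> [/p_natP[k ok] | [q [k [q_pr k_gt0 ok]]]].
  (* The exponent is positive because [p] divides the order, which excludes order 1. *)
  exists p, k; split=> //; rewrite lt0n; apply: contraTneq p_dvd => k0.
  by rewrite ok k0 dvdn1 neq_ltn prime_gt1 ?orbT.
have pq : p = q.
  apply/eqP; rewrite -dvdn_prime2 //.
  by move: p_dvd; rewrite ok Euclid_dvdX // => /andP[].
by rewrite ok pq pnatX pnat_id.
Qed.

Lemma simple_latin_affine_weyl (X : lquasigroup) :
    (1 < #|X|)%N -> affine_lq X -> simple_lq X -> latin X -> cycle_set X ->
  exists (p n : nat) (rho : {lrmorphism weyl 'F_p -> 'M['F_p]_n})
         (ua : rho weyl_a \in unitmx) (c : 'cV['F_p]_n),
    [/\ prime p, irreducible_rep rho, rho weyl_b \in unitmx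
      & lq_iso X (Aff (mulmx (invmx (rho weyl_b)))
                      (mulmx_bij ua : bijective (mulmx (rho weyl_a))) c)].
Proof.
move=> X_gt1 [G [phi [psi [psi_bij [c [f f_bij fM]]]]]] [_ simpleX] latX [cycX _].
have irr := aff_simple_irreducible (lq_iso_congruences f_bij fM simpleX).
have phi_inj := (latin_aff _ _ _).1 (lq_iso_latin f_bij fM latX).
have rel := (cycle_identity_aff _ _ _).1 (lq_iso_cycle_identity f_bij fM cycX).
have G_gt1 : (1 < #|G|)%N by rewrite -(bij_eq_card f_bij).
have [p p_pr Gp] := irreducible_exponent G_gt1 irr.
have [n [h [h_bij hD]]] := elementary_abelian_column p_pr G_gt1 Gp.
have [g hK gK] := h_bij.
have gD : {morph g : x y / x + y}.
  by move=> x y; apply: (bij_inj h_bij); rewrite hD !gK.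
have matrix_of (u : {additive G -> G}) :
    exists A : 'M['F_p]_n.+1, forall x, h (u x) = A *m h x.
  have [|A AE] := @additive_Fp_mulmx p _ _ (h \o u \o g).
    by move=> x y /=; rewrite gD raddfD hD.
  by exists A => x; rewrite -AE /= hK.
have [[A AE] [P PE]] := (matrix_of psi, matrix_of phi).
have unit_of (u : {additive G -> G}) (M : 'M['F_p]_n.+1) : injective u ->
    (forall x, h (u x) = M *m h x) -> M \in unitmx.
  move=> u_inj ME; apply: unitmx_inj => v w; rewrite -(gK v) -(gK w) -!ME.
  by move=> /(bij_inj h_bij)/u_inj ->.
have uA := unit_of _ _ (bij_inj psi_bij) AE.
have uP := unit_of _ _ phi_inj PE.
have uB : invmx P \in unitmx by rewrite unitmx_inv.
(* [A] and [P] are the matrices of [psi] and [phi], so [b] has to act as the inverse of [P]. *)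
have AB : A * invmx P - invmx P * A = 1.
  apply/(weyl_inv_relation A uB) => v; rewrite invmxK -(gK v).
  by rewrite -!PE -!AE -!PE -hD rel.
have [rho [rhoa rhob]] := weyl_universal AB.
have ua : rho weyl_a \in unitmx by rewrite rhoa.
have ub : rho weyl_b \in unitmx by rewrite rhob.
exists p, n.+1, rho, ua, (h c); split=> //.
  apply/(irreducible_rep_pair ub); split=> // U [U0 UB] UP UA.
  have h0 : h 0 = 0 by apply: (addrI (h 0)); rewrite -hD !addr0.
  (* An invariant subgroup of column vectors is pulled back along [h] to [G], where irreducibility
     is known. *)
  have U'zmod : zmod_closed [pred x | h x \in U].
    have hB x y : h (x - y) = h x - h y.
      by apply: (addIr (h y)); rewrite -hD !subrK.
    by split=> [|x y]; rewrite !inE ?h0 ?hB //; apply: UB.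
  case: (irr _ U'zmod) => [x|x|U'0|U'all]; rewrite ?inE.
  - by move=> /UP; rewrite /= rhob invmxK PE.
  - by move=> /UA; rewrite /= rhoa AE.
  - left=> v; rewrite -(gK v); have := U'0 (g v); rewrite inE => ->.
    by rewrite -(inj_eq (bij_inj h_bij)) h0.
  - by right=> v; rewrite -(gK v); apply: U'all.
exists (h \o f); first exact: bij_comp.
by move=> x y; rewrite /= fM /= /aff_op !hD rhoa rhob invmxK PE AE.
Qed.

Theorem theorem50 :
  (forall (p n : nat) (rho : {lrmorphism weyl 'F_p -> 'M['F_p]_n})
          (ua : rho weyl_a \in unitmx) (ub : rho weyl_b \in unitmx)
          (c : 'cV['F_p]_n),
     prime p -> irreducible_rep rho ->
     let phi := invmx (rho weyl_b) in
     let psi := rho weyl_a in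
     let X := Aff (mulmx phi) (mulmx_bij ua : bijective (mulmx psi)) c in
     [/\ simple_lq X, latin X, affine_lq X & cycle_set X]
     /\ ((p.-group (mulgroup X))%g <-> 
           prime_power_order (mulmx_bij ua : bijective (mulmx psi))))
  /\
  (forall X : lquasigroup,
     (1 < #|X|)%N -> affine_lq X -> simple_lq X -> latin X -> cycle_set X ->
     exists (p n : nat) (rho : {lrmorphism weyl 'F_p -> 'M['F_p]_n})
            (ua : rho weyl_a \in unitmx) (c : 'cV['F_p]_n),
       [/\ prime p, irreducible_rep rho, rho weyl_b \in unitmx
         & lq_iso X (Aff (mulmx (invmx (rho weyl_b)))
                         (mulmx_bij ua : bijective (mulmx (rho weyl_a))) c)]).
Proof.
split=> [p n rho ua ub c p_pr irr | X]; last exact: simple_latin_affine_weyl.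
split; first exact: latin_simple_cycle_affine.
exact: mulgroup_pgroup_prime_power.
Qed.
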